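(* Let $m\ge1$ be an integer, let $c>1$ be a real constant, and let $N=\lfloor c\,2^m n\rfloor$. Let $\omega(n)$ be any function with $\omega(n)\to\infty$ as $n\to\infty$, growing slowly enough that $\frac{1}{c^{1/m}}\big(1+\frac{\omega(n)}{n}\big)\in[0,1]$. Then there is a constant $M=M(c,m)>0$ such that $$p_u=\frac{1}{c^{1/m}}\Big(1+\frac{\omega(n)}{n}\Big)\quad\text{and}\quad p_\ell=\frac{1}{c^{1/m}}\Big(1-\sqrt{\frac{M\log n}{n}}\,\Big)$$ are a Ramsey upper threshold and a Ramsey lower threshold of $K_{m,n}$ in $\mathcal{G}(N,p)$, respectively.
   Context: All graphs are finite and simple. $K_{m,n}$ is the complete bipartite graph with parts of sizes $m$ and $n$. For graphs $F$ and $G$, $F\to G$ means that every coloring of the edges of $F$ with the two colors red and blue contains a monochromatic copy of $G$ (as a not necessarily induced subgraph). $\mathcal{G}(N,p)$ is the Erdős–Rényi random graph space on a labelled vertex set of size $N$, in which each edge of $K_N$ appears independently with probability $p$. Probability functions $p_u=p_u(N)$ and $p_\ell=p_\ell(N)$ are called a Ramsey upper threshold and a Ramsey lower threshold of $G$ in $\mathcal{G}(N,p)$, respectively, if $$\lim_{N\to\infty}\Pr[F\in\mathcal{G}(N,p): F\to G]=\begin{cases}1&\text{if } p\ge p_u,\\ 0&\text{if } p\le p_\ell,\end{cases}$$ where $p=p(N)\in[0,1]$ may depend on $N$. Here $G=K_{m,n}$ depends on $n$, with $N=\lfloor c2^mn\rfloor$ and $m,c$ fixed, so the limit is taken as $n\to\infty$;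 $p_\ell$ is considered for $n$ large enough that it is nonnegative. *)

(* Defs.v *)
From mathcomp Require Import all_boot all_order all_algebra.
From mathcomp Require Import all_classical all_reals all_analysis.
Import Order.TTheory GRing.Theory Num.Theory numFieldNormedType.Exports.

Set Implicit Arguments.
Unset Strict Implicit.
Unset Printing Implicit Defensive.

Local Open Scope set_scope.
Local Open Scope ring_scope.

(* A simple graph on a finite vertex type is represented by its edge set, a
   set of 2-element sets of vertices. *)
Definition complete_edges (V : finType) : {set {set V}} :=
  [set e : {set V} | #|e| == 2%N].

Definition complete_bipartite (m n : nat) : {set {set 'I_m + 'I_n}} :=
  [set [set inl i; inr j] | i : 'I_m, j : 'I_n].

Definition has_copy (V W : finType) (H : {set {set V}}) (G : {set {set W}}) :
    bool :=
  [exists f : {ffun W -> V}, injectiveb f && [forall e in G, f @: e \in H]].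

(* A colouring is given on all vertex sets; only its values on the edges of F
   matter. *)
Definition ramsey_arrow (V W : finType) (F : {set {set V}})
    (G : {set {set W}}) : bool :=
  [forall col : {ffun {set V} -> bool},
    [exists b : bool, has_copy [set e in F | col e == b] G]].

Section Gnp.
Variables (R : realType) (N : nat) (p : R).

Definition gnp_weight (F : {set {set 'I_N}}) : R :=
  \prod_(e in complete_edges 'I_N) (if e \in F then p else 1 - p).

Definition gnp_prob (A : pred {set {set 'I_N}}) : R :=
  \sum_(F : {set {set 'I_N}} | (F \subset complete_edges 'I_N) && A F)
    gnp_weight F.

End Gnp.

Section Thresholds.
Local Open Scope classical_set_scope.
(* The n-th random graph has N n vertices and its probability is p n; the n-th
   target graph is G n.  Since p_u and p_l need only make sense for large n,
   the constraints involving them are imposed eventually. *)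
Variables (R : realType) (N : nat -> nat) (W : nat -> finType).
Variable G : forall n, {set {set W n}}.

Definition ramsey_prob (p : nat -> R) (n : nat) : R :=
  gnp_prob (p n) (fun F : {set {set 'I_(N n)}} => ramsey_arrow F (G n)).

Definition ramsey_upper_threshold (pu : nat -> R) : Prop :=
  (\forall n \near \oo, 0 <= pu n <= 1) /\
  forall p : nat -> R, (forall n, 0 <= p n <= 1) ->
    (\forall n \near \oo, pu n <= p n) ->
    ramsey_prob p n @[n --> \oo] --> (1 : R).

Definition ramsey_lower_threshold (pl : nat -> R) : Prop :=
  (\forall n \near \oo, 0 <= pl n <= 1) /\
  forall p : nat -> R, (forall n, 0 <= p n <= 1) ->
    (\forall n \near \oo, p n <= pl n) ->
    ramsey_prob p n @[n --> \oo] --> (0 : R).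

End Thresholds.

(* [Num.truncn x] is the floor of x for x >= 0. *)
Definition host_size (R : realType) (m : nat) (c : R) (n : nat) : nat :=
  Num.truncn (c * 2 ^+ m * n%:R).

Definition p_upper (R : realType) (m : nat) (c : R) (omega : nat -> R)
    (n : nat) : R :=
  (c `^ (m%:R^-1))^-1 * (1 + omega n / n%:R).

Definition p_lower (R : realType) (m : nat) (c M : R) (n : nat) : R :=
  (c `^ (m%:R^-1))^-1 * (1 - Num.sqrt (M * ln n%:R / n%:R)).

(* Main.v *)
Require Import Defs.
From mathcomp Require Import all_boot all_order all_algebra.
From mathcomp Require Import all_classical all_reals all_analysis.
From mathcomp Require Import ring lra zify.
Import Order.TTheory GRing.Theory Num.Theory numFieldNormedType.Exports.
Local Open Scope classical_set_scope.
Local Open Scope ring_scope.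

Set Implicit Arguments.
Unset Strict Implicit.
Unset Printing Implicit Defensive.

(** Put r = c^(-1/m) and A = c 2^m, so that A (r/2)^m = 1 and N is about A n.

    Upper threshold. Two-colour F and count the pairs (f, v) with f an
    injective m-tuple of vertices all joined to v in one colour b: there are
    sum_(b, v) deg_b(v)^_m of them, and by convexity this is at least
    2 N (e(F)/N - m + 1)^m. If it exceeds 2 (n-1) N^m, some tuple has n common
    neighbours in one colour. With w = omega(n) and a small constant eps, a
    Chernoff bound gives e(F) > p C(N,2) - eps w N with probability tending to
    1, and the surplus factor 1 + w/n absorbs both this deviation and the
    lower-order terms.

    Lower threshold. Colour the edges uniformly at random, so that a fixed set
    E of edges lies in a given colour class with probability (p/2)^|E|. For a
    fixed m-tuple let X be its number of common neighbours in that class;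
    expanding (1+s)^X over subsets gives E(1+s)^X <= (1 + s (p/2)^m)^N. With
    s = d/2, where p <= r (1 - d), a union bound over tuples and colours leaves
    2 (A n)^m exp(- n d^2 / 4), which is 2 A^m / n for
    d^2 = 4 (m+1) log n / n. *)

(** * Independent random edges: moments and the lower tail of the edge count *)

Section RandomSubset.
Local Open Scope set_scope.

Lemma sum_subset_prod (R : comPzRingType) (T : finType) (K : {set T})
    (a b : T -> R) :
  \sum_(F : {set T} | F \subset K) \prod_(e in K) (if e \in F then a e else b e)
  = \prod_(e in K) (a e + b e).
Proof.
(* Outside [K] the weights are 0 and 1: the 0 kills every subset that leaves [K], the 1 is
   neutral. *)
pose a' e := if e \in K then a e else 0.
pose b' e := if e \in K then b e else 1.
transitivity (\prod_e (a' e + b' e)); last first.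
  rewrite [RHS]big_mkcond /=; apply: eq_bigr => e _.
  by rewrite /a' /b'; case: ifP => // _; rewrite add0r.
rewrite bigA_distr /= big_mkcond /=; apply: eq_bigr => F _.
case: ifPn => [FK|/subsetPn[e eF eK]].
  rewrite big_mkcond /=; apply: eq_bigr => e _; rewrite /a' /b'.
  case: ifPn => // eK; case: ifPn => // eF.
  by move/fintype.subsetP: FK eK => /(_ _ eF) ->.
by rewrite (bigD1 e) //= eF /a' (negbTE eK) mul0r.
Qed.

Lemma prod_subset_indic (R : comPzRingType) (T : finType) (E F : {set T}) :
  (E \subset F)%:R = \prod_(e in E) (e \in F)%:R :> R.
Proof.
case: (boolP (E \subset F)) => [/fintype.subsetP EF|/subsetPn[e eE eF]].
  by rewrite big1 // => e /EF ->.
by rewrite (bigD1 e) //= (negbTE eF) mul0r.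
Qed.

Section Gnp.
Variables (R : realType) (N : nat) (p : R).
Local Notation K := (complete_edges 'I_N).
Implicit Types (A B : pred {set {set 'I_N}}) (E F : {set {set 'I_N}}).

Lemma gnp_prob_sum A :
  gnp_prob p A = \sum_(F : {set {set 'I_N}} | F \subset K)
                   gnp_weight p F * (A F)%:R.
Proof.
rewrite /gnp_prob big_mkcondr /=; apply: eq_bigr => F _.
by case: (A F); rewrite ?mulr1 ?mulr0.
Qed.

(** Independence of the edges; the moments of the random graph below are instances of this
    factorisation. *)
Lemma sum_gnp_weight_prod (g h : {set 'I_N} -> R) :
  \sum_(F : {set {set 'I_N}} | F \subset K)
    gnp_weight p F * \prod_(e in K) (if e \in F then g e else h e)
  = \prod_(e in K) (p * g e + (1 - p) * h e).
Proof.
rewrite -sum_subset_prod; apply: eq_bigr => F _.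
by rewrite /gnp_weight -big_split; apply: eq_bigr => e _; case: ifP.
Qed.

Lemma sum_gnp_weight :
  \sum_(F : {set {set 'I_N}} | F \subset K) gnp_weight p F = 1.
Proof.
have := sum_gnp_weight_prod (fun=> 1) (fun=> 1).
rewrite [RHS]big1 => [<-|e _]; last by rewrite !mulr1 subrKC.
by apply: eq_bigr => F _; rewrite big1 ?mulr1 // => e _; case: ifP.
Qed.

Lemma gnp_prob_compl A : gnp_prob p A = 1 - gnp_prob p (fun F => ~~ A F).
Proof.
rewrite -sum_gnp_weight !gnp_prob_sum -sumrB; apply: eq_bigr => F _.
by case: (A F); rewrite ?mulr1 ?mulr0 ?subr0 ?subrr.
Qed.

Lemma sum_gnp_weight_supset E : E \subset K ->
  \sum_(F : {set {set 'I_N}} | F \subset K)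
    gnp_weight p F * (E \subset F)%:R = p ^+ #|E|.
Proof.
(* With factor 1 for a present edge and [h] for an absent one, the product over [K] is the indicator
   of [E \subset F]. *)
move=> EK; pose h e : R := (e \notin E)%:R.
have := sum_gnp_weight_prod (fun=> 1) h.
have -> : \prod_(e in K) (p * 1 + (1 - p) * h e) = p ^+ #|E|.
  rewrite (big_setID E) /= (finset.setIidPr EK) [X in _ * X = _]big1 ?mulr1.
    rewrite -prodr_const; apply: eq_bigr => e eE.
    by rewrite /h eE /= mulr0 addr0.
  by move=> e /setDP[_ eE]; rewrite /h eE /= mulr1 subrKC.
move=> <-; apply: eq_bigr => F _; congr (_ * _).
rewrite prod_subset_indic [RHS](big_setID E) /= (finset.setIidPr EK).
rewrite [X in _ = _ * X]big1 ?mulr1.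
  by apply: eq_bigr => e eE; rewrite /h eE; case: ifP.
by move=> e /setDP[_ eE]; rewrite /h eE; case: ifP.
Qed.

Hypothesis p01 : 0 <= p <= 1.

Lemma gnp_weight_ge0 F : 0 <= gnp_weight p F.
Proof.
case/andP: p01 => p0 p1; apply: prodr_ge0 => e _.
by case: ifP; rewrite ?subr_ge0.
Qed.

Lemma gnp_prob_ge0 A : 0 <= gnp_prob p A.
Proof. by apply: sumr_ge0 => F _; exact: gnp_weight_ge0. Qed.

Lemma gnp_prob_le A (f : {set {set 'I_N}} -> R) :
  (forall F, F \subset K -> (A F)%:R <= f F) ->
  gnp_prob p A
  <= \sum_(F : {set {set 'I_N}} | F \subset K) gnp_weight p F * f F.
Proof.
move=> Af; rewrite gnp_prob_sum; apply: ler_sum => F FK.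
by rewrite ler_wpM2l ?gnp_weight_ge0 // Af.
Qed.

Lemma gnp_prob_mono A B : (forall F, F \subset K -> A F -> B F) ->
  gnp_prob p A <= gnp_prob p B.
Proof.
move=> AB; rewrite [leRHS]gnp_prob_sum; apply: gnp_prob_le => F /AB.
by case: (A F) => [->|_]; rewrite ?ler0n.
Qed.

(** Chernoff bound with the tilt [s] left free; it is applied with [s] equal to 1/N. *)
Lemma gnp_card_lower_tail (s t : R) : 0 <= s ->
  gnp_prob p (fun F => #|F|%:R <= p * #|K|%:R - t)
  <= expR (p * #|K|%:R * s ^+ 2 - s * t).
Proof.
case/andP: p01 => p0 p1 s0; set T := p * #|K|%:R - t.
pose l := expR (- s).
(* Multiply by 1 + s: e^(-s) (1 + s) <= 1 <= 1 + s^3. *)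
have l_le : l <= 1 - s + s ^+ 2.
  have s1 : 0 < 1 + s by lra.
  rewrite -(ler_pM2r s1); apply: (@le_trans _ _ (l * expR s)).
    by rewrite ler_pM2l ?expR_gt0 // expR_ge1Dx.
  rewrite -expRD addNr expR0.
  have -> : (1 - s + s ^+ 2) * (1 + s) = 1 + s ^+ 3 by ring.
  by rewrite lerDl exprn_ge0.
(* The indicator of |F| <= T is at most e^(s (T - |F|)), which is a product over edges. *)
apply: (le_trans (@gnp_prob_le _ (fun F => expR (s * T) *
  \prod_(e in K) (if e \in F then l else 1)) _)).
  move=> F FK; rewrite -big_mkcondr /=.
  rewrite (eq_bigl (mem F)) => [|e /=]; last first.
    by case: (boolP (e \in F)) => eF; rewrite ?andbF // (fintype.subsetP FK).
  rewrite prodr_const -expRM_natr -expRD.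
  case: (boolP (_ <= T)) => FT; last exact: expR_ge0.
  apply: le_trans (expR_ge1Dx _); rewrite lerDl.
  by rewrite mulNr -mulrBr mulr_ge0 // subr_ge0.
under eq_bigr do rewrite mulrCA.
rewrite -mulr_sumr sum_gnp_weight_prod prodr_const.
have lp : 0 <= p * l + (1 - p) * 1 by rewrite addr_ge0 ?mulr_ge0 ?expR_ge0; lra.
apply: (@le_trans _ _ (expR (s * T) * expR (- p * (s - s ^+ 2)) ^+ #|K|)).
  rewrite ler_wpM2l ?expR_ge0 // lerXn2r ?nnegrE ?expR_ge0 //.
  by apply: le_trans (expR_ge1Dx _); nra.
by rewrite -expRM_natr -expRD ler_expR /T; lra.
Qed.

End Gnp.
End RandomSubset.

(** Convexity in tangent form, in place of Jensen's inequality: degrees of both colours can be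
    summed linearly against one common [z]. *)
Lemma exprn_ge_tangent (R : realDomainType) (k : nat) (y z : R) :
  0 <= y -> 0 <= z -> z ^+ k.+1 + k.+1%:R * z ^+ k * (y - z) <= y ^+ k.+1.
Proof.
move=> y0 z0; elim: k => [|k IH].
  by rewrite !expr1 expr0 !mul1r addrC subrK.
rewrite [leRHS]exprS; apply: le_trans (ler_wpM2l y0 IH).
(* y times the old tangent exceeds the new tangent by a multiple of a square. *)
rewrite -subr_ge0 (_ : _ - _ = k.+1%:R * z ^+ k * (y - z) ^+ 2).
  by rewrite mulr_ge0 ?sqr_ge0 // mulr_ge0 ?exprn_ge0.
by rewrite -[in k.+2%:R]natr1 !exprS; ring.
Qed.

(** The [j] factors d, d - 1, ... of the falling factorial are each at least d - k. *)
Lemma ffact_ge_expn (d j k : nat) : (j <= k.+1)%N -> ((d - k) ^ j <= d ^_ j)%N.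
Proof.
elim: j d k => [|j IH] d k jk; first by rewrite expn0 ffactn0.
rewrite ffactnS expnS leq_mul ?leq_subr //.
case: k jk => [|k] jk; first by have -> : j = 0%N by lia.
rewrite -(@leq_sub2rE 0) ?subn0 //.
by rewrite subnS -subn1 -subnDA addnC subnDA subn1 IH.
Qed.

(** * Counting common neighbours: density forces a monochromatic copy *)

Section CommonNeighbours.
Local Open Scope set_scope.
Variable V : finType.
Implicit Type H : {set {set V}}.

Definition nbrs H (v : V) := [set u | [set u; v] \in H].

(** When [H] has only 2-element sets, a common neighbour lies outside the image of [f], because
    [[set v; v]] is a singleton. *)
Definition common_nbrs (I : finType) H (f : I -> V) :=
  [set v | [forall i, [set f i; v] \in H]].

(** Double counting of incidences: each edge at [v] arises as {u, v} from some neighbour u. *)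
Lemma sum_card_nbrs H : H \subset complete_edges V ->
  (2 * #|H| <= \sum_v #|nbrs H v|)%N.
Proof.
move=> /fintype.subsetP HK.
have -> : (2 * #|H| = \sum_(e in H) \sum_v (v \in e))%N.
  rewrite mulnC -sum_nat_const; apply: eq_bigr => e /HK.
  by rewrite inE => /eqP <-; rewrite -sum1_card big_mkcond.
rewrite exchange_big /=; apply: leq_sum => v _.
have -> : (\sum_(e in H) (v \in e) = #|[set e in H | v \in e]|)%N.
  rewrite -sum1_card big_mkcond [RHS]big_mkcond; apply: eq_bigr => e _ /=.
  by rewrite inE; case: (e \in H).
apply: leq_trans (leq_imset_card (fun u => [set u; v]) _).
apply/subset_leq_card/fintype.subsetP => e; rewrite inE => /andP[eH ve].
have := HK _ eH; rewrite inE => /cards2P[x [y [xy exy]]].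
move: ve; rewrite exy !inE => /orP[] /eqP vE.
  by apply/imsetP; exists y; rewrite ?inE vE finset.setUC -?exy.
by apply/imsetP; exists x; rewrite ?inE vE -?exy.
Qed.

(** Both sides count the pairs (f, v) with [f] injective and all its values adjacent to v. *)
Lemma sum_ffact_nbrs (I : finType) H :
  (\sum_v #|nbrs H v| ^_ #|I| =
   \sum_(f : {ffun I -> V} | injectiveb f) #|common_nbrs H f|)%N.
Proof.
transitivity (\sum_v \sum_(f : {ffun I -> V} | injectiveb f)
                (v \in common_nbrs H f))%N.
  apply: eq_bigr => v _; rewrite -card_inj_ffuns_on -sum1_card big_mkcond.
  rewrite [RHS]big_mkcond /=; apply: eq_bigr => f _; rewrite inE andbC.
  case: (injectiveb f) => //=.
  rewrite (_ : (f \in _) = (v \in common_nbrs H f)); first by case: ifP.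
  rewrite [RHS]inE.
  by apply/ffun_onP/forallP => fH i; have := fH i; rewrite inE.
rewrite exchange_big /=; apply: eq_bigr => f _.
by rewrite -sum1_card [RHS]big_mkcond /=; apply: eq_bigr => v _; case: ifP.
Qed.

Lemma has_copy_complete_bipartiteP (m n : nat) H : H \subset complete_edges V ->
  reflect (exists2 f : {ffun 'I_m -> V},
             injective f & (n <= #|common_nbrs H f|)%N)
    (has_copy H (complete_bipartite m n)).
Proof.
move=> /fintype.subsetP HK; apply: (iffP existsP) => [[g]|[f f_inj nf]].
  move=> /andP[/injectiveP g_inj /forall_inP gH].
  exists [ffun i => g (inl i)]; first by move=> i j; rewrite !ffunE => /g_inj[].
  have gr_inj : injective (fun j : 'I_n => g (inr j)) by move=> i j /g_inj[].
  rewrite -[n in (n <= _)%N]card_ord -(card_codom gr_inj) subset_leq_card //.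
  apply/fintype.subsetP => _ /codomP[j ->]; rewrite inE; apply/forallP => i.
  have /gH : [set inl i; inr j] \in complete_bipartite m n by exact: imset2_f.
  by rewrite imsetU1 imset_set1 ffunE.
have Hneq i j : [set i; j] \in H -> i != j.
  by move=> /HK; rewrite inE cards2; case: (i != j).
have r_lt (j : 'I_n) : (j < #|common_nbrs H f|)%N by apply: leq_trans nf.
pose r (j : 'I_n) := enum_val (Ordinal (r_lt j)).
have fr i j : [set f i; r j] \in H.
  by have := enum_valP (Ordinal (r_lt j)); rewrite inE => /forallP.
exists [ffun x => match x with inl i => f i | inr j => r j end].
apply/andP; split.
  apply/injectiveP => -[i|i] [j|j]; rewrite !ffunE.
  - by move=> /f_inj ->.
  - by move=> fij; have := Hneq _ _ (fr i j); rewrite fij eqxx.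
  - by move=> fij; have := Hneq _ _ (fr j i); rewrite fij eqxx.
  - by move=> /enum_val_inj/(congr1 val) /= /val_inj ->.
apply/forall_inP => _ /imset2P[i j _ _ ->].
by rewrite imsetU1 imset_set1 !ffunE.
Qed.

(** Here z + k is a lower bound for the mean of the monochromatic degrees over all pairs (colour,
    vertex). Using the tangent at the same [z] in both colours makes only the total |F| matter, not
    how it splits. *)
Lemma ramsey_arrow_complete_bipartite (R : realDomainType) (F : {set {set V}})
    (k n : nat) (z : R) :
  F \subset complete_edges V -> 0 <= z ->
  #|V|%:R * (z + k%:R) <= #|F|%:R ->
  n%:R * #|V|%:R ^+ k.+1 < #|V|%:R * z ^+ k.+1 ->
  ramsey_arrow F (complete_bipartite k.+1 n.+1).
Proof.
move=> FK z0 zF zn; apply/forallP => col; apply/existsP.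
pose Fc b := [set e in F | col e == b].
have FcK b : Fc b \subset complete_edges V.
  apply: fintype.subset_trans FK; apply/fintype.subsetP => e.
  by rewrite inE => /andP[].
apply/existsP; rewrite -[X in is_true X]negbK negb_exists.
apply/negP => /forallP no.
have card_common b (f : {ffun 'I_k.+1 -> V}) : injectiveb f ->
    (#|common_nbrs (Fc b) f| <= n)%N.
  move=> /injectiveP f_inj; rewrite leqNgt; apply/negP => nf.
  by have := no b; case/has_copy_complete_bipartiteP; [exact: FcK|exists f].
have upper b : (\sum_v #|nbrs (Fc b) v| ^_ k.+1 <= n * #|V| ^ k.+1)%N.
  have := sum_ffact_nbrs 'I_k.+1 (Fc b); rewrite card_ord => ->.
  apply: (@leq_trans (\sum_(f : {ffun 'I_k.+1 -> V}) n)%N).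
    rewrite big_mkcond; apply: leq_sum => f _.
    by case: ifP => // /card_common.
  by rewrite sum_nat_const card_ffun card_ord mulnC.
have lower b : #|V|%:R * z ^+ k.+1
    + k.+1%:R * z ^+ k * (2 * #|Fc b|%:R - #|V|%:R * (k%:R + z))
    <= (\sum_v #|nbrs (Fc b) v| ^_ k.+1)%:R :> R.
  rewrite natr_sum; apply: (@le_trans _ _
    (\sum_v (z ^+ k.+1
             + k.+1%:R * z ^+ k * (#|nbrs (Fc b) v|%:R - (k%:R + z))))).
    rewrite big_split /= sumr_const -mulr_sumr.
    rewrite -[X in _ <= X + _]mulr_natl lerD2l.
    rewrite ler_wpM2l ?mulr_ge0 ?exprn_ge0 // sumrB sumr_const.
    rewrite -[X in _ <= _ - X]mulr_natl.
    rewrite lerD2r -natr_sum -natrM ler_nat; exact: sum_card_nbrs.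
  apply: ler_sum => v _; set d := #|_|.
  (* Truncated subtraction helps: [d - k] is nonnegative, as the tangent bound requires, and at
     least the real difference. *)
  apply: (@le_trans _ _ ((d - k) ^ k.+1)%N%:R); last first.
    by rewrite ler_nat ffact_ge_expn.
  rewrite natrX; apply: le_trans (exprn_ge_tangent _ _ z0); last by [].
  rewrite lerD2l ler_wpM2l ?mulr_ge0 ?exprn_ge0 // opprD addrA lerD2r.
  by rewrite lerBlDr -natrD ler_nat addnC -leq_subLR.
have card_Fc : (#|Fc true| + #|Fc false| = #|F|)%N.
  rewrite -(cardsID [set e | col e] F); congr (_ + _)%N; apply: eq_card => e.
    by rewrite !inE eqb_id.
  by rewrite !inE andbC eqbF_neg.
have excess : 0 <= k.+1%:R * z ^+ k * (2 * (#|F|%:R - #|V|%:R * (z + k%:R))).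
  by rewrite mulr_ge0 ?mulr_ge0 ?exprn_ge0 // subr_ge0.
have upperR b : (\sum_v #|nbrs (Fc b) v| ^_ k.+1)%:R
    <= n%:R * #|V|%:R ^+ k.+1 :> R.
  by rewrite -natrX -natrM ler_nat.
(* In the sum over the two colours the linear terms combine into [excess], and what is left
   contradicts [zn]. *)
have := lerD (le_trans (lower true) (upperR true))
             (le_trans (lower false) (upperR false)).
rewrite leNgt => /negP; apply.
move: excess zn; rewrite -card_Fc natrD.
move: (k.+1%:R * z ^+ k) (#|V|%:R * z ^+ k.+1) (n%:R * _) => x y w.
move: (#|Fc true|%:R) (#|Fc false|%:R) (#|V|%:R) (k%:R) => ct cf v k' excess wy.
have -> : y + x * (2 * ct - v * (k' + z)) + (y + x * (2 * cf - v * (k' + z)))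
    = y + y + x * (2 * (ct + cf - v * (z + k'))) by ring.
by rewrite ltr_wpDr // ltrD.
Qed.

End CommonNeighbours.

(** * Uniform random colourings and the union bound *)

Section RandomColouring.
Local Open Scope set_scope.

(** Reduces an exponential moment of |X| to the events that a fixed U lies in X, whose probabilities
    are explicit. *)
Lemma sum_subset_exprn (R : comPzRingType) (T : finType) (X : {set T}) (s : R) :
  \sum_(U : {set T}) s ^+ #|U| * (U \subset X)%:R = (s + 1) ^+ #|X|.
Proof.
rewrite -prodr_const -sum_subset_prod [RHS]big_mkcond /=; apply: eq_bigr => U _.
case: (boolP (U \subset X)) => UX; rewrite ?mulr0 // mulr1 -prodr_const.
rewrite -big_mkcondr /=; apply: eq_bigl => e.
by case: (boolP (e \in U)) => eU; rewrite ?andbF // (fintype.subsetP UX).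
Qed.

(** The average over colourings is kept unnormalised; the number 2^|T| of colourings cancels in the
    union bound. *)
Lemma sum_colourings_mono (R : numFieldType) (T : finType) (E : {set T})
    (b : bool) :
  \sum_(col : {ffun T -> bool}) (E \subset [set e | col e == b])%:R
  = 2 ^+ #|T| * 2^-1 ^+ #|E| :> R.
Proof.
pose g e x : R := if e \in E then (x == b)%:R else 1.
transitivity (\sum_(col : {ffun T -> bool}) \prod_e g e (col e)).
  apply: eq_bigr => col _; rewrite prod_subset_indic big_mkcond /=.
  by apply: eq_bigr => e _; rewrite inE.
rewrite -bigA_distr_bigA /=.
rewrite (eq_bigr (fun e => 2 * (if e \in E then 2^-1 else 1))).
  by rewrite big_split /= prodr_const -big_mkcond prodr_const.
move=> e _; rewrite big_bool /g; case: ifP => _; last by rewrite mulr1.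
rewrite divff ?pnatr_eq0 //.
by case: (b); rewrite /= ?addr0 ?add0r.
Qed.

Section Star.
Variables (V I : finType) (f : I -> V) (U : {set V}).

Definition star_edges : {set {set V}} := [set [set f i; v] | i : I, v : V in U].

Lemma subset_common_nbrs (H : {set {set V}}) :
  (U \subset common_nbrs H f) = (star_edges \subset H).
Proof.
apply/fintype.subsetP/fintype.subsetP => [UH _ /imset2P[i v _ vU ->]|EH v vU].
  by have := UH _ vU; rewrite inE => /forallP.
by rewrite inE; apply/forallP => i; apply: EH; exact: imset2_f.
Qed.

(** If all these sets are genuine edges, no vertex of [U] is a value of [f], so an edge determines
    its pair (i, v). *)
Lemma card_star_edges : injective f -> star_edges \subset complete_edges V ->
  #|star_edges| = (#|I| * #|U|)%N.
Proof.
move=> f_inj /fintype.subsetP EK.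
have fU i v : v \in U -> f i != v.
  move=> vU; have : [set f i; v] \in star_edges by exact: imset2_f.
  by move=> /EK; rewrite inE cards2; case: (f i != v).
have -> : star_edges
    = [set [set f x.1; x.2] | x in finset.setX [set: I] U].
  apply/setP => e; apply/imset2P/imsetP => [[i v _ vU ->]|[[i v]]].
    by exists (i, v); rewrite // finset.in_setX inE.
  by rewrite finset.in_setX => /andP[_ vU] ->; exists i v.
rewrite card_in_imset ?cardsX ?cardsT //.
move=> [i v] [j w]; rewrite !finset.in_setX !inE /= => vU wU ijE.
have := finset.set21 (f i) v; rewrite ijE !inE (negbTE (fU i w wU)) orbF.
have := finset.set22 (f i) v; rewrite ijE !inE eq_sym (negbTE (fU j v vU)) /=.
by move=> /eqP -> /eqP /f_inj ->.
Qed.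

End Star.

Section Union.
Variables (R : realType) (N : nat) (p : R).
Hypothesis p01 : 0 <= p <= 1.
Local Notation K := (complete_edges 'I_N).

Definition colour_class (F : {set {set 'I_N}}) (col : {ffun {set 'I_N} -> bool})
  (b : bool) := [set e in F | col e == b].

(** The event asks for m |U| given edges, each present with colour [b]. It is only an inequality
    because the left side vanishes when [U] meets the image of [f]. *)
Lemma sum_weight_common_nbrs (m : nat) (f : 'I_m -> 'I_N) (U : {set 'I_N}) b :
  injective f ->
  \sum_(F : {set {set 'I_N}} | F \subset K) gnp_weight p F *
    (\sum_col (U \subset common_nbrs (colour_class F col b) f)%:R)
  <= 2 ^+ #|{set 'I_N}| * ((p / 2) ^+ m) ^+ #|U|.
Proof.
case/andP: p01 => p0 p1 f_inj.
have split F col : (U \subset common_nbrs (colour_class F col b) f)%:R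
    = (star_edges f U \subset F)%:R
      * (star_edges f U \subset [set e | col e == b])%:R :> R.
  have -> : colour_class F col b = F :&: [set e | col e == b].
    by apply/setP => e; rewrite !inE.
  by rewrite subset_common_nbrs finset.subsetI -natrM mulnb.
under eq_bigr => F _ do under eq_bigr do rewrite split.
under eq_bigr do rewrite -mulr_sumr sum_colourings_mono mulrA.
rewrite -mulr_suml; case: (boolP (star_edges f U \subset K)) => EK.
  rewrite sum_gnp_weight_supset // mulrCA -exprMn card_star_edges // card_ord.
  by rewrite exprM.
rewrite big1 ?mul0r; last first.
  move=> F FK; case: (boolP (_ \subset _)) => [EF|]; last by rewrite mulr0.
  by rewrite (fintype.subset_trans EF FK) in EK.
by rewrite mulr_ge0 ?exprn_ge0 ?divr_ge0.
Qed.

(** If [F] arrows, every colouring has a colour and a tuple contributing at least (s + 1)^n. *)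
Lemma ramsey_arrow_indic_le (m n : nat) (s : R) (F : {set {set 'I_N}}) :
  0 <= s -> F \subset K ->
  (ramsey_arrow F (complete_bipartite m n))%:R
    * (2 ^+ #|{set 'I_N}| * (s + 1) ^+ n)
  <= \sum_(col : {ffun {set 'I_N} -> bool}) \sum_(b : bool)
       \sum_(f : {ffun 'I_m -> 'I_N} | injectiveb f)
         (s + 1) ^+ #|common_nbrs (colour_class F col b) f|.
Proof.
move=> s0 FK; have s1 : 1 <= s + 1 by rewrite lerDr.
have s1' : 0 <= s + 1 by rewrite (le_trans _ s1).
case: (boolP (ramsey_arrow _ _)) => [arr|_]; last first.
  by rewrite mul0r; do 3 apply: sumr_ge0 => ? _; rewrite exprn_ge0.
have -> : true%:R * (2 ^+ #|{set 'I_N}| * (s + 1) ^+ n)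
    = \sum_(col : {ffun {set 'I_N} -> bool}) (s + 1) ^+ n.
  by rewrite sumr_const card_ffun card_bool mul1r -[RHS]mulr_natl natrX.
apply: ler_sum => col _.
have /existsP[b] := forallP arr col.
have FcK : colour_class F col b \subset K.
  apply: fintype.subset_trans FK; apply/fintype.subsetP => e.
  by rewrite inE => /andP[].
case/(has_copy_complete_bipartiteP _ _ FcK) => f f_inj nf.
rewrite (bigD1 b) //= (bigD1 f) /=; last exact/injectiveP.
rewrite -addrA -[leLHS]addr0 lerD //; first exact: ler_weXn2l.
rewrite addr_ge0 // ?sumr_ge0 // => *; first by rewrite exprn_ge0.
by rewrite sumr_ge0 // => *; rewrite exprn_ge0.
Qed.

Lemma gnp_prob_ramsey_arrow_le (m n : nat) (s : R) : 0 <= s ->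
  gnp_prob p
    (fun F : {set {set 'I_N}} => ramsey_arrow F (complete_bipartite m n))
  <= 2 * N%:R ^+ m * (s * (p / 2) ^+ m + 1) ^+ N / (s + 1) ^+ n.
Proof.
case/andP: (p01) => p0 p1 s0; have s1 : 0 < s + 1 by rewrite ltr_wpDl.
set q := (p / 2) ^+ m; set C : R := 2 ^+ #|{set 'I_N}|.
have C0 : 0 < C by rewrite exprn_gt0.
have D0 : 0 < C * (s + 1) ^+ n by rewrite mulr_gt0 ?exprn_gt0.
apply: (le_trans (gnp_prob_le p01 (f := fun F =>
   (\sum_(col : {ffun {set 'I_N} -> bool}) \sum_(b : bool)
       \sum_(f : {ffun 'I_m -> 'I_N} | injectiveb f) \sum_(U : {set 'I_N})
         s ^+ #|U| * (U \subset common_nbrs (colour_class F col b) f)%:R)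
      / (C * (s + 1) ^+ n)) _)).
  move=> F FK; rewrite ler_pdivlMr //.
  apply: le_trans (ramsey_arrow_indic_le _ _ s0 FK) _.
  apply: ler_sum => col _; apply: ler_sum => b _; apply: ler_sum => f _.
  by rewrite sum_subset_exprn.
under eq_bigr do rewrite mulrA.
rewrite -mulr_suml ler_pdivrMr //.
have -> : 2 * N%:R ^+ m * (s * q + 1) ^+ N / (s + 1) ^+ n * (C * (s + 1) ^+ n)
    = \sum_(b : bool) \sum_(f : {ffun 'I_m -> 'I_N}) \sum_(U : {set 'I_N})
        s ^+ #|U| * (C * q ^+ #|U|).
  have -> : \sum_(U : {set 'I_N}) s ^+ #|U| * (C * q ^+ #|U|)
      = C * (s * q + 1) ^+ N.
    rewrite -[N in _ ^+ N]card_ord -cardsT -sum_subset_exprn mulr_sumr.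
    by apply: eq_bigr => U _; rewrite finset.subsetT mulr1 exprMn mulrCA.
  rewrite !sumr_const -mulrnA card_ffun !card_ord card_bool.
  rewrite -[RHS]mulr_natl natrM natrX.
  rewrite [LHS]mulrCA divfK ?expf_neq0 ?lt0r_neq0 //.
  by move: (C) (N%:R ^+ m) (_ ^+ N) => x y w; ring.
(* Exchange the sums so that graph and colouring are averaged for fixed [b], [f] and [U]. *)
have -> : \sum_(F : {set {set 'I_N}} | F \subset K) gnp_weight p F *
    (\sum_(col : {ffun {set 'I_N} -> bool}) \sum_(b : bool)
       \sum_(f : {ffun 'I_m -> 'I_N} | injectiveb f) \sum_(U : {set 'I_N})
         s ^+ #|U| * (U \subset common_nbrs (colour_class F col b) f)%:R)
  = \sum_(b : bool) \sum_(f : {ffun 'I_m -> 'I_N} | injectiveb f)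
      \sum_(U : {set 'I_N}) s ^+ #|U| *
      (\sum_(F : {set {set 'I_N}} | F \subset K) gnp_weight p F *
        (\sum_col (U \subset common_nbrs (colour_class F col b) f)%:R)).
  under eq_bigr do rewrite exchange_big mulr_sumr /=.
  rewrite exchange_big; apply: eq_bigr => b _ /=.
  under eq_bigr do rewrite exchange_big mulr_sumr /=.
  rewrite exchange_big; apply: eq_bigr => f _ /=.
  under eq_bigr do rewrite exchange_big mulr_sumr /=.
  rewrite exchange_big; apply: eq_bigr => U _ /=.
  rewrite mulr_sumr; apply: eq_bigr => F _.
  by rewrite !mulr_sumr; apply: eq_bigr => col _; rewrite mulrCA.
apply: ler_sum => b _; rewrite big_mkcond; apply: ler_sum => f _.
have t0 (U : {set 'I_N}) : 0 <= s ^+ #|U| * (C * q ^+ #|U|).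
  by rewrite !mulr_ge0 ?exprn_ge0 ?divr_ge0.
case: ifPn => [/injectiveP f_inj|_]; last exact: sumr_ge0.
apply: ler_sum => U _; rewrite ler_wpM2l ?exprn_ge0 //.
exact: sum_weight_common_nbrs.
Qed.

End Union.
End RandomColouring.

(** * Quantitative estimates for both thresholds *)

Section Estimates.
Variables (R : realType) (k : nat) (r A : R).
Local Notation m := k.+1.

(* [r ^+ 2 / (8 * m%:R)] is the constant eps above, so that [u] collects the
   edge deficit per vertex and the lower-order term m. *)
Lemma star_count_ineq (p w n N u : R) (z := p * N / 2 - u) :
  0 < r -> r <= 1 -> 2 <= A -> A * (r / 2) ^+ m = 1 ->
  u = r ^+ 2 / (8 * m%:R) * w + m%:R ->
  0 < n -> n <= N -> A * n - 1 <= N -> r * (1 + w / n) <= p -> p <= 1 ->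
  (1 + 2 * m%:R ^+ 2 / r) / r < w -> 4 * m%:R <= r * n ->
  0 <= z /\ (n - 1) * N ^+ m < N * z ^+ m.
Proof.
move=> r0 r1 A2 rA uE n0 nN AnN wp p1 w_gt mn.
have m1 : 1 <= m%:R :> R by rewrite ler1n.
(* The 1 is the rounding loss in N >= A n - 1; the rest is the effect of the term m of [u]. *)
set B := 1 + 2 * m%:R ^+ 2 / r in w_gt.
have B0 : 0 < B by rewrite ltr_pwDl // divr_ge0 ?mulr_ge0 ?exprn_ge0 // ltW.
have w0 : 0 < w by apply: lt_trans w_gt; rewrite divr_gt0.
have Brw : B < r * w by rewrite mulrC -ltr_pdivrMr.
have x0 : 0 < w / n by rewrite divr_gt0.
set x := w / n in wp x0.
have wE : w = x * n by rewrite divfK ?gt_eqF.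
have rx : r * (1 + x) <= 1 by exact: le_trans wp p1.
(* The constraint p <= 1 caps w, which keeps the deficit [u] below p N / 2. *)
have rwn : r * w <= n by have := ler_wpM2r (ltW n0) rx; rewrite wE; nra.
have e_le : r ^+ 2 / (8 * m%:R) * w <= r * n / 8.
  have -> : r ^+ 2 / (8 * m%:R) * w = (r * (r * w) / 8) / m%:R.
    by field; rewrite gt_eqF //; lra.
  rewrite ler_pdivrMr; last lra.
  by nra.
have u0 : 0 <= u.
  rewrite uE addr_ge0 ?ler0n //.
  by rewrite mulr_ge0 ?divr_ge0 ?exprn_ge0 ?mulr_ge0 // ltW.
have rp : r <= p by apply: le_trans wp; nra.
have N0 : 0 < N by lra.
have p0 : 0 < p by exact: lt_le_trans rp.
have pN : r * n <= p * N by rewrite ler_pM // ltW.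
have rn : 0 < r * n by rewrite mulr_gt0.
have u_le : u <= 3 / 8 * (r * n).
  by rewrite uE; move: e_le mn; move: (_ / (8 * m%:R) * w) => t tn ?; lra.
have z0 : 0 <= z by rewrite /z; lra.
split=> //.
pose y := p * N / 2.
have y0 : 0 < y by rewrite /y divr_gt0 // mulr_gt0.
have NE : N = 2 / p * y by rewrite /y; field; rewrite gt_eqF.
(* Tangent at y with z - y = -u; since N = (2/p) y and r <= p, the linear term is a multiple of
   y^m. *)
have Nz : y ^+ m * (N - m%:R * u * (2 / r)) <= N * z ^+ m.
  apply: le_trans (ler_wpM2l (ltW N0) (exprn_ge_tangent k z0 (ltW y0))).
  have -> : z - y = - u by rewrite /z /y; ring.
  have : N * y ^+ k <= 2 / r * y ^+ m.
    have -> : N * y ^+ k = 2 / p * y ^+ m by rewrite exprS mulrA -NE.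
    rewrite ler_wpM2r ?exprn_ge0 ?(ltW y0) // ler_pM2l // lef_pV2 //.
  have : 0 <= m%:R * u by rewrite mulr_ge0.
  by nra.
apply: lt_le_trans Nz.
have yE : y ^+ m = N ^+ m * (p / 2) ^+ m.
  by rewrite -exprMn /y; congr (_ ^+ _); field.
rewrite yE -mulrA [X in X < _]mulrC ltr_pM2l ?exprn_gt0 //.
set D := N - _.
have D_ge : A * n - B - r * w / 4 <= D.
  have -> : D = N - (2 * m%:R ^+ 2 / r + r * w / 4).
    by rewrite /D uE; field; rewrite gt_eqF //= gt_eqF //; lra.
  by rewrite /B; lra.
have D0 : 0 <= D by have := ler_wpM2r (ltW n0) A2; lra.
(* Of the m surplus factors 1 + x, one is enough. *)
have pA : (1 + x) / A <= (p / 2) ^+ m.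
  have rAV : A^-1 = (r / 2) ^+ m.
    by apply: (@mulfI _ A); rewrite ?rA ?divff // gt_eqF //; lra.
  rewrite rAV [X in X <= _]mulrC.
  apply: (@le_trans _ _ ((r * (1 + x) / 2) ^+ m)).
    have -> : r * (1 + x) / 2 = r / 2 * (1 + x) by ring.
    rewrite [leRHS]exprMn ler_wpM2l ?exprn_ge0 ?divr_ge0 ?(ltW r0) //.
    by rewrite ler_eXnr //; lra.
  by rewrite lerXn2r ?nnegrE //; nra.
apply: lt_le_trans (ler_wpM2r D0 pA).
rewrite mulrAC ltr_pdivlMr; last lra.
apply: (@lt_le_trans _ _ ((1 + x) * (A * n - B - r * w / 4))); last first.
  by rewrite ler_wpM2l //; lra.
(* The gain A w is at least 2 w, while r (1 + x) <= 1 and B / r < w keep the loss below 5 w / 4. *)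
have -> : (1 + x) * (A * n - B - r * w / 4)
    = A * n + A * w - (r * (1 + x)) * (B / r + w / 4).
  by rewrite wE; field; rewrite gt_eqF.
have : 0 < B / r by rewrite divr_gt0.
by nra.
Qed.

(** As (p/2)^m N <= (1 - d) n, the exponent is at most n (s^2 - s d), minimal at s = d/2. *)
Lemma gnp_prob_ramsey_arrow_le_expR (N n : nat) (p d : R) :
  0 < r -> r <= 1 -> 2 <= A -> A * (r / 2) ^+ m = 1 ->
  0 <= p -> 0 <= d -> d <= 1 -> p <= r * (1 - d) -> N%:R <= A * n%:R ->
  gnp_prob p
    (fun F : {set {set 'I_N}} => ramsey_arrow F (complete_bipartite m n))
  <= 2 * (A * n%:R) ^+ m * expR (- (n%:R * d ^+ 2 / 4)).
Proof.
move=> r0 r1 A2 rA p0 d0 d1 pr NA.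
have p01 : 0 <= p <= 1 by rewrite p0 (le_trans pr) //; nra.
pose s := d / 2; have s0 : 0 <= s by rewrite divr_ge0.
apply: le_trans (gnp_prob_ramsey_arrow_le N p01 m n s0) _.
rewrite -[leLHS]mulrA; apply: ler_pM.
- by rewrite mulr_ge0 ?exprn_ge0.
- by rewrite divr_ge0 ?exprn_ge0 ?addr_ge0 ?mulr_ge0 ?exprn_ge0 ?divr_ge0.
- by rewrite ler_pM2l // lerXn2r ?nnegrE // mulr_ge0 //; lra.
set q := (p / 2) ^+ m.
have q0 : 0 <= q by rewrite exprn_ge0 ?divr_ge0.
have qN : q * N%:R <= (1 - d) * n%:R.
  have qA : q * A <= 1 - d.
    apply: (@le_trans _ _ ((r * (1 - d) / 2) ^+ m * A)).
      rewrite ler_wpM2r //; first lra.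
      by rewrite lerXn2r ?nnegrE //; nra.
    have -> : r * (1 - d) / 2 = r / 2 * (1 - d) by ring.
    rewrite [(r / 2 * _) ^+ _]exprMn mulrAC [_ * A]mulrC rA mul1r.
    by rewrite ler_iXnr //; lra.
  apply: (@le_trans _ _ (q * (A * n%:R))); first exact: ler_wpM2l.
  by rewrite mulrA ler_wpM2r.
have num : (s * q + 1) ^+ N <= expR (s * (1 - d) * n%:R).
  apply: (@le_trans _ _ (expR (s * q) ^+ N)).
    rewrite lerXn2r ?nnegrE ?expR_ge0 ?addr_ge0 ?mulr_ge0 //.
    by rewrite addrC expR_ge1Dx.
  by rewrite -expRM_natr ler_expR -[leLHS]mulrA -[leRHS]mulrA ler_wpM2l.
have den : ((s + 1) ^+ n)^-1 <= expR (- (s - s ^+ 2) * n%:R).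
  rewrite expRM_natr -exprVn lerXn2r ?nnegrE ?expR_ge0 ?invr_ge0 ?addr_ge0 //.
  apply: le_trans (expR_ge1Dx _).
  rewrite -[leLHS]mul1r ler_pdivrMr; last lra.
  have -> : (1 + - (s - s ^+ 2)) * (s + 1) = 1 + s ^+ 3 by ring.
  by rewrite lerDl exprn_ge0.
apply: (le_trans (ler_pM _ _ num den)).
- by rewrite exprn_ge0 // addr_ge0 // mulr_ge0.
- by rewrite invr_ge0 exprn_ge0 // addr_ge0.
by rewrite -expRD ler_expR /s; lra.
Qed.

Lemma card_complete_edges (N : nat) :
  #|complete_edges 'I_N|%:R = N%:R * (N%:R - 1) / 2 :> R.
Proof.
rewrite card_draws card_ord; apply: (@mulIf _ 2); rewrite ?pnatr_eq0 //.
rewrite divfK ?pnatr_eq0 // -natrM (bin_ffact N 2).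
case: N => [|N]; first by rewrite mul0r.
by rewrite !ffactnS ffactn0 muln1 natrM -natr1 addrK.
Qed.

Lemma gnp_prob_not_ramsey_arrow_le (N n : nat) (p w : R) :
  0 < r -> r <= 1 -> 2 <= A -> A * (r / 2) ^+ m = 1 ->
  (0 < n)%N -> n%:R <= N%:R :> R -> A * n%:R - 1 <= N%:R ->
  r * (1 + w / n%:R) <= p -> p <= 1 ->
  (1 + 2 * m%:R ^+ 2 / r) / r < w -> 4 * m%:R <= r * n%:R ->
  gnp_prob p
    (fun F : {set {set 'I_N}} => ~~ ramsey_arrow F (complete_bipartite m n))
  <= expR (1 - r ^+ 2 / (8 * m%:R) * w).
Proof.
move=> r0 r1 A2 rA n0 nN AnN wp p1 w_gt mn; set e := r ^+ 2 / (8 * m%:R).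
have nR0 : 0 < n%:R :> R by rewrite ltr0n.
have N0 : 0 < N%:R :> R by exact: lt_le_trans nN.
have w0 : 0 < w.
  apply: lt_trans w_gt; rewrite divr_gt0 // ltr_pwDl //.
  by rewrite divr_ge0 ?mulr_ge0 ?exprn_ge0 // ltW.
have p0 : 0 <= p.
  apply: le_trans wp; rewrite mulr_ge0 ?(ltW r0) //.
  by rewrite addr_ge0 // divr_ge0 ?ltW.
have [z0 zN] := star_count_ineq r0 r1 A2 rA erefl nR0 nN AnN wp p1 w_gt mn.
rewrite -/e in z0 zN; set z := p * _ / 2 - _ in z0 zN.
have p01 : 0 <= p <= 1 by rewrite p0.
have Ninv0 : 0 <= (N%:R : R)^-1 by rewrite invr_ge0 ltW.
apply: (@le_trans _ _ (gnp_prob p (fun F : {set {set 'I_N}} =>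
    #|F|%:R <= p * #|complete_edges 'I_N|%:R - e * w * N%:R))); last first.
  (* With tilt 1/N the quadratic term is (p/2) (1 - 1/N) <= 1, and the deviation e w N contributes
     -e w. *)
  apply: le_trans (gnp_card_lower_tail N p01 _ Ninv0) _.
  rewrite ler_expR card_complete_edges.
  have -> : p * (N%:R * (N%:R - 1) / 2) * N%:R^-1 ^+ 2
      - N%:R^-1 * (e * w * N%:R)
    = p / 2 * (1 - N%:R^-1) - e * w by field; rewrite gt_eqF.
  by rewrite lerD2r; nra.
apply: gnp_prob_mono => // F FK; apply: contraNT; rewrite -ltNge => FT.
rewrite -(prednK n0).
(* The requirement z + k <= p (N - 1) / 2 - e w reduces to p/2 <= 1, because [z] subtracts m = k +
   1. *)
apply: (ramsey_arrow_complete_bipartite FK z0); rewrite card_ord.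
  apply: le_trans (ltW FT); rewrite card_complete_edges /z -(natr1 k).
  by nra.
by rewrite -subn1 natrB.
Qed.

End Estimates.

(** * The constants r and A, and the rounding of N *)

Section Constants.
Variables (R : realType) (k : nat) (c : R).
Local Notation m := k.+1.
Local Notation r := (c `^ (m%:R^-1))^-1.
Local Notation A := (c * 2 ^+ m).
Hypothesis c1 : 1 < c.

Lemma powR_invn_exprn : (c `^ (m%:R^-1)) ^+ m = c.
Proof.
have c0 : 0 <= c by rewrite ltW // (lt_trans _ c1).
by rewrite -powR_mulrn ?powR_ge0 // -powRrM mulVf ?pnatr_eq0 // powRr1.
Qed.

Lemma invn_powR_gt0 : 0 < r.
Proof. by rewrite invr_gt0 powR_gt0 // (lt_trans _ c1). Qed.

Lemma invn_powR_le1 : r <= 1.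
Proof.
have x0 := invn_powR_gt0; rewrite invr_gt0 in x0.
rewrite invf_le1 // leNgt; apply/negP => x1.
suff : c <= 1 by rewrite leNgt c1.
by rewrite -powR_invn_exprn exprn_ile1 ?powR_ge0 // ltW.
Qed.

Lemma host_const_ge2 : 2 <= A.
Proof.
rewrite exprS mulrCA -[leLHS]mulr1 ler_pM2l // -[leLHS]mulr1.
by rewrite ler_pM // ?(ltW c1) // exprn_ege1 // ler1n.
Qed.

Lemma host_const_invn_powR : A * (r / 2) ^+ m = 1.
Proof.
rewrite exprMn exprVn powR_invn_exprn exprVn mulrACA !divff ?mulr1 //.
by rewrite gt_eqF // (lt_trans _ c1).
Qed.

Lemma host_size_bounds (n : nat) :
  (host_size m c n)%:R <= A * n%:R /\ A * n%:R - 1 <= (host_size m c n)%:R.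
Proof.
have A0 : 0 <= A * n%:R by rewrite mulr_ge0 // (le_trans _ host_const_ge2).
split; first by rewrite /host_size truncn_le.
by rewrite lerBlDr natr1 ltW // truncnS_gt.
Qed.

End Constants.

(** With q the square root of n, M ln n = 2 M ln q <= 2 M q <= q^2 once q >= 2 M. *)
Lemma near_sqrt_ln_div_le1 (R : realType) (M : R) : 0 < M ->
  \forall n \near \oo, Num.sqrt (M * ln n%:R / n%:R) <= 1.
Proof.
move=> M0; near=> n.
have n0 : 0 < n%:R :> R by rewrite ltr0n; near: n; exact: nbhs_infty_gt.
have Mn : (2 * M) ^+ 2 <= n%:R by near: n; exact: nbhs_infty_ger.
set q := Num.sqrt (n%:R : R).
have q0 : 0 < q by rewrite sqrtr_gt0.
have qE : n%:R = q ^+ 2 by rewrite sqr_sqrtr // ltW.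
have Mq : 2 * M <= q.
  by rewrite -(@ler_pXn2r _ 2) -?qE // nnegrE ?mulr_ge0 // ltW.
rewrite -[leRHS]sqrtr1 ler_wsqrtr // ler_pdivrMr // mul1r qE lnXn // -mulr_natl.
have := ln_sublinear q0; have := ltW q0; nra.
Unshelve. all: by end_near.
Qed.

(** * Passage to the limit for both thresholds *)

Theorem theorem3 (R : realType) (m : nat) (c : R)
    (hm : (1 <= m)%N) (hc : 1 < c) :
  exists M : R, 0 < M /\
    forall omega : nat -> R,
      omega n @[n --> \oo] --> +oo ->
      (\forall n \near \oo, 0 <= p_upper m c omega n <= 1) ->
      ramsey_upper_threshold (host_size m c) (complete_bipartite m)
        (p_upper m c omega) /\
      ramsey_lower_threshold (host_size m c) (complete_bipartite m)
        (p_lower m c M).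
Proof.
case: m hm => // k _.
have r0 := invn_powR_gt0 k hc; have r1 := invn_powR_le1 k hc.
have A2 := host_const_ge2 k hc; have rA := host_const_invn_powR k hc.
have Nn n := host_size_bounds k hc n.
set A := c * 2 ^+ k.+1 in A2 rA Nn.
(* Chosen so that e^(-n d^2 / 4) = n^-(m+1), which beats the n^m of the union bound by a factor
   n. *)
pose M : R := 4 * k.+2%:R; have M0 : 0 < M by rewrite mulr_gt0.
exists M; split => // omega omega_oo pu01.
rewrite /ramsey_upper_threshold /ramsey_lower_threshold.
rewrite /p_upper /p_lower in pu01 *.
set r := (c `^ (k.+1%:R^-1))^-1 in r0 r1 rA pu01 *.
split; split=> //.
- move=> p p01 pu_le; apply/cvgrPdist_le => e e0.
  set d := r ^+ 2 / (8 * k.+1%:R).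
  have d0 : 0 < d by rewrite divr_gt0 ?exprn_gt0.
  near=> n.
  have n0 : (0 < n)%N by near: n; exact: nbhs_infty_gt.
  have nR0 : 1 <= n%:R :> R by rewrite ler1n.
  have [_ AnN] := Nn n.
  have nN : n%:R <= (host_size k.+1 c n)%:R :> R.
    by have := ler_wpM2r (ltW (lt_le_trans ltr01 nR0)) A2; lra.
  have pun : r * (1 + omega n / n%:R) <= p n by near: n.
  have /andP[p0 p1] := p01 n.
  have w_gt : (1 + 2 * k.+1%:R ^+ 2 / r) / r < omega n.
    by near: n; move/cvgryPgt : omega_oo; apply.
  have mn : 4 * k.+1%:R <= r * n%:R.
    by rewrite [leRHS]mulrC -ler_pdivrMr //; near: n; exact: nbhs_infty_ger.
  (* This suffices because e^(x - 1) >= x, applied to x = [d * omega n], which is then at least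
     [e^-1]. *)
  have we : d^-1 * e^-1 <= omega n by near: n; move/cvgryPge : omega_oo; apply.
  have tail := gnp_prob_not_ramsey_arrow_le r0 r1 A2 rA n0 nN AnN pun p1 w_gt
    mn.
  rewrite -/d in tail; rewrite /ramsey_prob gnp_prob_compl subKr.
  rewrite ger0_norm ?gnp_prob_ge0 //; apply: le_trans tail _.
  have edw : e^-1 <= d * omega n by rewrite -ler_pdivrMl.
  have dw0 : 0 < d * omega n by apply: lt_le_trans edw; rewrite invr_gt0.
  have -> : 1 - d * omega n = - (d * omega n - 1) by rewrite opprB.
  rewrite expRN invf_ple ?posrE ?expR_gt0 //; apply: le_trans edw _.
  by apply: le_trans (expR_ge1Dx _); rewrite addrC subrK.
- near=> n.
  have d1 : Num.sqrt (M * ln n%:R / n%:R) <= 1.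
    by near: n; exact: near_sqrt_ln_div_le1.
  have d0 : 0 <= Num.sqrt (M * ln n%:R / n%:R) by exact: sqrtr_ge0.
  by apply/andP; split; nra.
move=> p p01 p_le; apply/cvgrPdist_le => e e0; near=> n.
have n0 : (0 < n)%N by near: n; exact: nbhs_infty_gt.
have nR0 : 1 <= n%:R :> R by rewrite ler1n.
have d1 : Num.sqrt (M * ln n%:R / n%:R) <= 1.
  by near: n; exact: near_sqrt_ln_div_le1.
have pn_le : p n <= r * (1 - Num.sqrt (M * ln n%:R / n%:R)) by near: n.
set d := Num.sqrt _ in d1 pn_le.
have /andP[p0 p1] := p01 n; have [NA _] := Nn n.
rewrite sub0r normrN ger0_norm ?gnp_prob_ge0 //.
have d0 : 0 <= d := sqrtr_ge0 _.
apply: le_trans (gnp_prob_ramsey_arrow_le_expR r0 r1 A2 rA p0 d0 d1 pn_le NA) _.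
have -> : n%:R * d ^+ 2 / 4 = ln (n%:R : R) * k.+2%:R.
  rewrite sqr_sqrtr; last by rewrite divr_ge0 // mulr_ge0 ?ln_ge0 // ltW.
  by rewrite /M; field; rewrite gt_eqF // ltr0n.
rewrite expRN expRM_natr lnK ?posrE ?ltr0n //.
have -> : 2 * (A * n%:R) ^+ k.+1 / n%:R ^+ k.+2 = 2 * A ^+ k.+1 / n%:R.
  have nN0 : n%:R != 0 :> R by rewrite gt_eqF // ltr0n.
  rewrite exprMn [n%:R ^+ k.+2]exprS invfM mulrA [LHS]mulrAC mulrA.
  by rewrite mulfK ?expf_neq0.
rewrite ler_pdivrMr ?ltr0n // [leRHS]mulrC -ler_pdivrMr //.
by near: n; exact: nbhs_infty_ger.
Unshelve. all: by end_near.
Qed.
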